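(* Let $Y$ be a lower semilattice and let $\{(B_{\alpha}, +, \cdot, -, \ast) \mid \alpha \in Y\}$ be a family of pairwise disjoint square skew left braces. For each pair $\alpha,\beta\in Y$ with $\alpha \geq \beta$, let $\phi_{\alpha,\beta}: B_{\alpha}\to B_{\beta}$ be a square skew left brace homomorphism such that (1) $\phi_{\alpha,\alpha}$ is the identity automorphism of $B_{\alpha}$ for every $\alpha \in Y$; (2) $\phi_{\beta,\gamma}\phi_{\alpha,\beta} = \phi_{\alpha,\gamma}$ for all $\alpha, \beta, \gamma \in Y$ with $\alpha \geq \beta \geq \gamma$. Define two binary operations $+$ and $\cdot$ on $S = \bigcup_{\alpha\in Y} B_{\alpha}$ by $$a+b= \phi_{\alpha,\alpha\beta}(a)+\phi_{\beta,\alpha\beta}(b),\qquad ab= \phi_{\alpha,\alpha\beta}(a)\, \phi_{\beta,\alpha\beta}(b)$$ for all $a\in B_{\alpha}$, $b\in B_{\beta}$ (the operations on the right being those of $B_{\alpha\beta}$), and let the unary operations $-$ and $\ast$ on $S$ restrict on each $B_\alpha$ to those of $B_\alpha$. Then $(S, +, \cdot, -, \ast)$ is a dual weak left $\star$-brace (called a strong semilattice of the square skew left braces $B_\alpha$ and denoted by $[Y; B_\alpha;\phi_{\alpha,\beta}]$). Conversely, any dual weak left $\star$-brace can be constructed in this way.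
   Context: A regular $\star$-semigroup $(S,\cdot,\ast)$ is a semigroup $(S,\cdot)$ with a unary operation $x\mapsto x^\ast$ satisfying $xx^\ast x=x$, $(x^\ast)^\ast=x$, $(xy)^\ast=y^\ast x^\ast$ for all $x,y\in S$. A weak left $\star$-brace $(S,+,\cdot,-,\ast)$ consists of a set $S$ such that $(S,+,-)$ and $(S,\cdot,\ast)$ are regular $\star$-semigroups (with unary operations $x\mapsto -x$ and $x\mapsto x^\ast$ respectively; $+$ need not be commutative) and $x(y+z)=xy-x+xz$ and $-x+x=xx^\ast$ for all $x,y,z\in S$. Here $xy=x\cdot y$, $x-y$ means $x+(-y)$, and multiplication has higher precedence than addition. It is a dual weak left $\star$-brace if moreover $x-x=x^\ast x$ for all $x\in S$. A square skew left brace is a dual weak left $\star$-brace $(S,+,\cdot,-,\ast)$ such that $(S,\cdot)$ is a completely simple semigroup, i.e. it is simple (Green's relation $\mathcal J$ is universal) and completely regular ($a\,\mathcal H\,a^2$ for all $a\in S$). A homomorphism of square skew left braces is a map preserving the four operations $+,\cdot,-,\ast$. A lower semilattice $(Y,\leq)$ is a partially ordered set in which any two elements $\alpha,\beta$ have a greatest lower bound, denoted $\alpha\beta$. *)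

(* Defs.v *)
From mathcomp Require Import all_boot all_order.
From mathcomp Require Import boolp classical_sets.

Set Implicit Arguments.
Unset Strict Implicit.
Unset Printing Implicit Defensive.

Import Order.TTheory.

Declare Scope brace_scope.
Delimit Scope brace_scope with B.

Section RegularStarSemigroup.
Variables (T : Type) (op : T -> T -> T) (inv : T -> T).

Record is_regular_star_semigroup : Prop := RegularStarSemigroup {
  rss_assoc : associative op;
  rss_regular : forall x, op (op x (inv x)) x = x;
  rss_involutive : involutive inv;
  rss_anti : forall x y, inv (op x y) = op (inv y) (inv x)
}.

End RegularStarSemigroup.

Section Green.
Local Open Scope classical_set_scope.
Variables (T : Type) (op : T -> T -> T).

(* The principal ideals S^1 a, a S^1 and S^1 a S^1: the singleton [set a]
   accounts for the identity adjoined to S. *)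
Definition principal_left_ideal (a : T) : set T :=
  [set a] `|` [set op s a | s in setT].

Definition principal_right_ideal (a : T) : set T :=
  [set a] `|` [set op a s | s in setT].

Definition principal_ideal (a : T) : set T :=
  [set a] `|` [set op s a | s in setT] `|` [set op a s | s in setT]
  `|` [set op (op s a) t | s in setT & t in setT].

Definition greenL (a b : T) : Prop :=
  principal_left_ideal a = principal_left_ideal b.

Definition greenR (a b : T) : Prop :=
  principal_right_ideal a = principal_right_ideal b.

Definition greenH (a b : T) : Prop := greenL a b /\ greenR a b.

Definition greenJ (a b : T) : Prop := principal_ideal a = principal_ideal b.

Definition is_simple : Prop := forall a b, greenJ a b.

Definition is_completely_regular : Prop := forall a, greenH a (op a a).

Definition is_completely_simple : Prop := is_simple /\ is_completely_regular.

End Green.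

Record braceAlgebra : Type := BraceAlgebra {
  brace_sort :> Type;
  badd : brace_sort -> brace_sort -> brace_sort;
  bmul : brace_sort -> brace_sort -> brace_sort;
  bopp : brace_sort -> brace_sort;
  bstar : brace_sort -> brace_sort
}.

Notation "x + y" := (badd x y) : brace_scope.
Notation "x * y" := (bmul x y) : brace_scope.
Notation "- x" := (bopp x) : brace_scope.
Notation "x - y" := (badd x (bopp y)) : brace_scope.
Notation "x ^*" := (bstar x) (at level 1, left associativity, format "x ^*")
  : brace_scope.

Local Open Scope brace_scope.

Record is_weak_left_star_brace (S : braceAlgebra) : Prop := WeakLeftStarBrace {
  wlb_add : is_regular_star_semigroup (@badd S) (@bopp S);
  wlb_mul : is_regular_star_semigroup (@bmul S) (@bstar S);
  wlb_distr : forall x y z : S, x * (y + z) = x * y - x + x * z;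
  wlb_proj : forall x : S, - x + x = x * x^*
}.

Definition is_dual_weak_left_star_brace (S : braceAlgebra) : Prop :=
  is_weak_left_star_brace S /\ forall x : S, x - x = x^* * x.

Definition is_square_skew_left_brace (S : braceAlgebra) : Prop :=
  is_dual_weak_left_star_brace S /\ is_completely_simple (@bmul S).

Record is_brace_hom (S T : braceAlgebra) (f : S -> T) : Prop := BraceHom {
  hom_add : forall x y, f (x + y) = f x + f y;
  hom_mul : forall x y, f (x * y) = f x * f y;
  hom_opp : forall x, f (- x) = - f x;
  hom_star : forall x, f (x^*) = (f x)^*
}.

Section StrongSemilattice.
Local Open Scope order_scope.
Context (d : Order.disp_t) (Y : meetSemilatticeType d) (B : Y -> braceAlgebra).
Variable phi : forall a b : Y, b <= a -> B a -> B b.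

Record is_strong_system : Prop := StrongSystem {
  sys_square : forall a, is_square_skew_left_brace (B a);
  sys_hom : forall a b (le_ba : b <= a), is_brace_hom (phi le_ba);
  sys_id : forall a (le_aa : a <= a) (x : B a), phi le_aa x = x;
  sys_comp : forall a b c (le_ba : b <= a) (le_cb : c <= b) (le_ca : c <= a)
    (x : B a), phi le_cb (phi le_ba x) = phi le_ca x
}.

(* The union of the pairwise disjoint sets B a is the total space of the
   family: an element is a pair of an index a and an element of B a. *)
Definition strong_semilattice : braceAlgebra :=
  @BraceAlgebra {a : Y & B a}
    (fun x y => existT (fun a => B a : Type) (tag x `&` tag y)
       (phi (leIl _ _) (tagged x)
        + phi (leIr _ _) (tagged y))%B)
    (fun x y => existT (fun a => B a : Type) (tag x `&` tag y)
       (phi (leIl _ _) (tagged x)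
        * phi (leIr _ _) (tagged y))%B)
    (fun x => existT (fun a => B a : Type) (tag x) (- tagged x)%B)
    (fun x => existT (fun a => B a : Type) (tag x) (tagged x)^*%B).

End StrongSemilattice.

(* Main.v *)
Require Import Defs.
From HB Require Import structures.
From mathcomp Require Import all_boot all_order.
From mathcomp Require Import boolp classical_sets.

(** Write l(x) = xx^* = -x+x and r(x) = x^*x = x-x: both operations have the
    same projections.  Expanding e(f+f) and e(f+e) with the brace law gives
    ef = f+e for all projections e and f.  If e and h lie below f, expanding
    e(f+h) = eh makes e and h commute, so the projections below a given one are
    determined by their J-classes; this forces x e x^* = -x+e+x, and expanding
    x = x(-x^* + x^* l(x)) then yields l(x)r(x)l(x) = l(x), i.e. S is completely
    regular.  The J-classes form a semilattice, and the structure map to the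
    class of b sends x to e x, where e is the unique projection below l(x) in
    that class; e x is also x+e, so this is a homomorphism for both operations. *)

Set Implicit Arguments.
Unset Strict Implicit.
Unset Printing Implicit Defensive.

Import Order.TTheory.

Local Open Scope brace_scope.

(* Locked so that rewriting with associativity does not see through the
   projections of an element. *)
Definition lproj {S : braceAlgebra} (x : S) : S := locked (x * x^*).
Definition rproj {S : braceAlgebra} (x : S) : S := locked (x^* * x).

(** * Projections and J-classes *)

Section DualWeakBrace.
Variables (S : braceAlgebra) (hS : is_dual_weak_left_star_brace S).
Implicit Types (x y z a b c e f g h k : S).

Let addA := rss_assoc (wlb_add hS.1).
Let addK x : x - x + x = x := rss_regular (wlb_add hS.1) x.
Let oppK x : - - x = x := rss_involutive (wlb_add hS.1) x.
Let oppD x y : - (x + y) = - y - x := rss_anti (wlb_add hS.1) x y.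
Let mulA := rss_assoc (wlb_mul hS.1).
Let mulK x : x * x^* * x = x := rss_regular (wlb_mul hS.1) x.
Let starK x : x^*^* = x := rss_involutive (wlb_mul hS.1) x.
Let starM x y : (x * y)^* = y^* * x^* := rss_anti (wlb_mul hS.1) x y.
Let mulD x y z : x * (y + z) = x * y - x + x * z := wlb_distr hS.1 x y z.

Lemma lprojE x : lproj x = x * x^*. Proof. by rewrite /lproj -lock. Qed.

Lemma rprojE x : rproj x = x^* * x. Proof. by rewrite /rproj -lock. Qed.

Definition is_proj e := e^* = e /\ e * e = e.

Lemma lproj_add x : lproj x = - x + x.
Proof. by rewrite lprojE (wlb_proj hS.1). Qed.

Lemma rproj_add x : rproj x = x - x.
Proof. by rewrite rprojE hS.2. Qed.

Lemma lprojK x : lproj x * x = x. Proof. by rewrite lprojE mulK. Qed.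

Lemma rprojK x : x * rproj x = x. Proof. by rewrite rprojE mulA mulK. Qed.

Lemma add_lproj x : x + lproj x = x. Proof. by rewrite lproj_add addA addK. Qed.

Lemma add_rproj x : rproj x + x = x. Proof. by rewrite rproj_add addK. Qed.

Lemma lprojP x : is_proj (lproj x).
Proof. by split; rewrite lprojE ?starM ?starK // mulA mulK. Qed.

Lemma rprojP x : is_proj (rproj x).
Proof. by split; rewrite rprojE ?starM ?starK // -mulA (mulA x) mulK. Qed.

Lemma lproj_star x : lproj x^* = rproj x.
Proof. by rewrite lprojE rprojE starK. Qed.

Lemma rproj_star x : rproj x^* = lproj x.
Proof. by rewrite lprojE rprojE starK. Qed.

Lemma lproj_opp x : lproj (- x) = rproj x.
Proof. by rewrite lproj_add rproj_add oppK. Qed.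

Lemma lproj_id e : is_proj e -> lproj e = e.
Proof. by case=> se ee; rewrite lprojE se. Qed.

(** A projection equals l(e) = -e + e, which negation fixes. *)
Lemma opp_proj e : is_proj e -> - e = e.
Proof.
move=> pe; rewrite -[in RHS](lproj_id pe) -[in LHS](lproj_id pe).
by rewrite lproj_add oppD oppK.
Qed.

Lemma add_proj e : is_proj e -> e + e = e.
Proof.
by move=> pe; rewrite -{1}(opp_proj pe) -lproj_add lproj_id.
Qed.

Lemma proj_conj x e : is_proj e -> is_proj (x * e * x^*).
Proof.
case=> se ee; suff -> : x * e * x^* = lproj (x * e) by exact: lprojP.
by rewrite lprojE starM se !mulA -(mulA x e e) ee.
Qed.

Lemma proj_sandwich e f : is_proj e -> is_proj f -> is_proj (e * f * e).
Proof. by move=> [se _] pf; rewrite -{2}se; apply: proj_conj. Qed.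

Lemma proj_le_sym e g : is_proj e -> is_proj g -> g * e = g -> e * g = g.
Proof. by move=> [se _] [sg _] ge; rewrite -{1}se -{1}sg -starM ge. Qed.

Lemma proj_ge_sym e g : is_proj e -> is_proj g -> e * g = g -> g * e = g.
Proof. by move=> [se _] [sg _] eg; rewrite -{1}se -{1}sg -starM eg. Qed.

Lemma lprojM e f : is_proj e -> is_proj f -> lproj (e * f) = e * f * e.
Proof.
by move=> [se _] [sf ff]; rewrite lprojE starM se sf !mulA -(mulA e f f) ff.
Qed.

Lemma rprojM e f : is_proj e -> is_proj f -> rproj (e * f) = f * e * f.
Proof.
by move=> [se ee] [sf _]; rewrite rprojE starM se sf !mulA -(mulA f e e) ee.
Qed.

(** * Sums and products of two projections *)

Lemma projM_mid e f : is_proj e -> is_proj f -> e * f = e * f + e + e * f.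
Proof. by move=> pe pf; rewrite -{1}(add_proj pf) mulD opp_proj. Qed.

(** The multiplicative order implies the additive one. The sum k = g + e satisfies r(k) = g, g <=
    l(k) and k k = k, hence g = l(k) r(k) = k (k k)^* k = k. *)
Lemma proj_le_add e g :
  is_proj e -> is_proj g -> g * e = g -> g + e = g /\ e + g = g.
Proof.
move=> pe pg ge.
have eg := proj_le_sym pe pg ge.
have [[se ee] [sg gg]] := (pe, pg).
have geg : g + e + g = g by have := projM_mid pe pg; rewrite eg => <-.
pose k := g + e.
have gk : g * k = g by rewrite mulD gg ge opp_proj // !add_proj.
have rk : rproj k = g.
  by rewrite rproj_add /k oppD !opp_proj // addA -(addA g) add_proj // geg.
have lk : lproj k = e + k.
  by rewrite lproj_add /k oppD !opp_proj // addA -(addA e g) add_proj // addA.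
have glk : g * lproj k = g by rewrite lk mulD gk ge opp_proj // !add_proj.
have lkg : lproj k * g = g := proj_le_sym (lprojP k) pg glk.
have kk : k * k = k.
  by have := congr1 (fun t => k * t) gk; rewrite -rk mulA !rprojK.
have kg : k = g.
  rewrite -{1}lkg -rk lprojE rprojE mulA -(mulA k) -starM kk.
  by rewrite mulK.
have gE : g + e = g by exact: kg.
split=> //.
by rewrite -{1}(opp_proj pe) -{1}(opp_proj pg) -oppD gE opp_proj.
Qed.

(** Put a = e f, so that e f e = -a + a and f e f = a - a. From a = a + e + a one gets -a = e f e +
    e + f e f; negate, and let e f e absorb e. *)
Lemma projM_sandwich e f : is_proj e -> is_proj f ->
  e * f = f * e * f + e * f * e.
Proof.
move=> pe pf; have [pg pg'] := (proj_sandwich pe pf, proj_sandwich pf pe).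
have eg : e + e * f * e = e * f * e.
  by apply: (proj_le_add pe pg _).2; rewrite -mulA pe.2.
rewrite -eg -[LHS]oppK.
suff -> : - (e * f) = e * f * e + e + f * e * f.
  by rewrite !oppD !opp_proj // addA.
rewrite -lprojM // -rprojM // lproj_add rproj_add.
set a := e * f; have aE : a = a + e + a := projM_mid pe pf.
have -> : - a + a + e + (a - a) = - a + (a + e + a) - a by rewrite !addA.
rewrite -aE; have := addK (- a); by rewrite oppK.
Qed.

Lemma projM_opp e f : is_proj e -> is_proj f -> - (e * f) = f * e.
Proof.
move=> pe pf; rewrite (projM_sandwich pe pf) [RHS](projM_sandwich pf pe) oppD.
by rewrite !opp_proj //; apply: proj_sandwich.
Qed.

(** Converse of [proj_le_add]. Expanding g (e + g) = g gives g e + g = g; in g e = e g e + g e g the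
    last term absorbs g, so g e + g is also g e. *)
Lemma proj_add_le e g : is_proj e -> is_proj g -> e + g = g -> g * e = g.
Proof.
move=> pe pg eg; have pgeg := proj_sandwich pg pe.
have geg : g * e + g = g.
  have := congr1 (fun t => g * t) eg; rewrite mulD pg.2 opp_proj //.
  by rewrite -addA add_proj.
have [gegg _] : g * e * g + g = g * e * g /\ g + g * e * g = g * e * g.
  by apply: (proj_le_add pg pgeg); rewrite -mulA pg.2.
rewrite -[RHS]geg [in RHS](projM_sandwich pg pe) -addA gegg.
exact: projM_sandwich.
Qed.

(** Put p = e + f + e and g = e f e. As p lies below e, expanding p = e p writes p as e + e f, which
    ends in g, so p + g = p. Also g + p = g, and negating this gives p + g = g. *)
Lemma proj_addE e f : is_proj e -> is_proj f -> e + f + e = e * f * e.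
Proof.
move=> pe pf; set p := e + f + e; set g := e * f * e.
have [pg pg'] := (proj_sandwich pe pf, proj_sandwich pf pe).
have pE : p = lproj (f + e).
  by rewrite lproj_add oppD !opp_proj // addA -(addA e f) add_proj.
have pp : is_proj p by rewrite pE; apply: lprojP.
have fe_e : e * (f + e) = e * f.
  rewrite mulD pe.2 opp_proj // -addA add_proj // projM_sandwich // -addA.
  by rewrite (proj_le_add pe pg _).1 // -mulA pe.2.
have pe_p : p * e = p.
  by apply: proj_add_le => //; rewrite /p !addA add_proj.
have ep : e * p = p := proj_le_sym pe pp pe_p.
have pE2 : p = e + (f * e * f + g).
  rewrite -projM_sandwich // -ep /p -addA mulD pe.2 opp_proj // fe_e.
  by rewrite add_proj.
have pg_p : p + g = p by rewrite pE2 -!addA add_proj.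
have gsg : g = g + f * e * f + g.
  have gE : g = f * e + e * f by rewrite -(projM_opp pf pe) -rproj_add rprojM.
  rewrite [LHS]gE [f * e in LHS]projM_sandwich // -/g.
  rewrite [e * f in LHS]projM_sandwich //.
  by rewrite -/g addA -(addA g) add_proj.
have gp : g + p = g.
  have [ge _] : g + e = g /\ e + g = g.
    by apply: proj_le_add => //; rewrite -mulA pe.2.
  by rewrite pE2 !addA ge -gsg.
by have := congr1 (@bopp S) gp; rewrite oppD !opp_proj // pg_p.
Qed.

Lemma add_proj_idem e f : is_proj e -> is_proj f -> e + f + (e + f) = e + f.
Proof.
move=> pe pf; rewrite -{3}[e + f]addK oppD !opp_proj // !addA.
by rewrite -(addA e f f) add_proj // -(addA (e + f) e e) add_proj.
Qed.

Lemma projM_add e f : is_proj e -> is_proj f -> e * f = f + e.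
Proof.
move=> pe pf; rewrite projM_sandwich // -!proj_addE //.
have idem := add_proj_idem pf pe.
by rewrite !addA -(addA (f + e) f e) idem -addA idem.
Qed.

(** * Projections below a common projection *)

(** Expanding e h = e (f + h) gives e h = e + e h = e + h + e = e h e, a projection. Negation fixes
    projections but turns e h into h e. *)
Lemma proj_commute e h f : is_proj e -> is_proj h -> is_proj f ->
  e * f = e -> h * f = h -> e * h = h * e.
Proof.
move=> pe ph pf ef hf; have [_ fh] := proj_le_add pf ph hf.
have eh : e * h = e + e * h.
  by rewrite -{1}fh mulD ef opp_proj // add_proj.
have ehe : e * h = e * h * e.
  by rewrite [LHS]eh [e * h in LHS]projM_add // addA proj_addE.
by rewrite -(projM_opp pe ph) [in RHS]ehe opp_proj //; apply: proj_sandwich.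
Qed.

(** The last two hypotheses say that e and h are J-related; as e and h commute, both equal e h. *)
Lemma proj_uniq e h f : is_proj e -> is_proj h -> is_proj f ->
  e * f = e -> h * f = h -> e * h * e = e -> h * e * h = h -> e = h.
Proof.
move=> pe ph pf ef hf ehe heh; have C := proj_commute pe ph pf ef hf.
by rewrite -ehe C -mulA pe.2 -{2}heh -C -mulA ph.2.
Qed.

(** Since -a is idempotent too, a - a - a + a = a and -a + a + a - a = -a. Doubling the middle term
    of l(a) + r(a) + l(a) then reduces it to -a + a. *)
Lemma add_idem_projs a : a + a = a ->
  [/\ rproj a + lproj a = a, lproj a * rproj a * lproj a = lproj a
    & rproj a * lproj a * rproj a = rproj a].
Proof.
move=> aa; have na : - a - a = - a by rewrite -oppD aa.
have ra : rproj a + lproj a = a.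
  by rewrite lproj_add rproj_add !addA -(addA a) na addK.
have la : lproj a + rproj a = - a.
  by rewrite lproj_add rproj_add !addA -(addA (- a)) aa -{2}(oppK a) addK.
have [pl pr] := (lprojP a, rprojP a); split; first by [].
  rewrite -proj_addE // -{1}(add_proj pr) addA la -addA ra.
  by rewrite lproj_add.
rewrite -proj_addE // -{1}(add_proj pl) addA ra -addA la.
by rewrite rproj_add.
Qed.

(** * Conjugation of projections *)

Lemma star_lproj x : x^* * lproj x = x^*.
Proof. by rewrite -{2}[x^*]rprojK rproj_star. Qed.

Lemma lproj_oppK x : lproj x - x = - x.
Proof. by rewrite -{2}[- x]addK oppK lproj_add. Qed.

(* [- x + x * e] is an additive idempotent whose two projections [- x + e + x]
   and [x * e * x^*] are J-related and lie below [lproj x], hence coincide. *)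
Lemma conj_restrict x e : is_proj e -> e * rproj x = e ->
  x * e * x^* = - x + e + x /\ x * e = e + x.
Proof.
move=> pe ef; have pf := rprojP x; have pm := lprojP x.
have [_ fe] := proj_le_add pf pe ef.
have rxe : rproj (x * e) = e.
  rewrite rprojE starM pe.1 mulA -(mulA e) -rprojE ef pe.2 //.
have exe : e + x * e = x * e by rewrite -{1}rxe add_rproj.
pose a := - x + x * e.
have aa : a + a = a.
  have := congr1 (fun t => - x + t) (mulD x e e).
  by rewrite add_proj // /a !addA.
have la : lproj a = x * e * x^*.
  rewrite lproj_add /a oppD oppK addA -(addA (- (x * e))) -rproj_add.
  rewrite -{2}exe addA -(addA _ _ e) fe -addA exe -lproj_add.
  by rewrite lprojE starM pe.1 mulA -(mulA x e e) pe.2.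
have ra : rproj a = - x + e + x.
  by rewrite rproj_add /a oppD oppK addA -(addA (- x)) -rproj_add rxe.
have [aE ulu rlr] := add_idem_projs aa.
have uv : lproj a = rproj a.
  have [pla pra] := (lprojP a, rprojP a).
  apply: (proj_uniq (f := lproj x)) => //.
    by rewrite la -mulA star_lproj.
  by apply: proj_add_le => //; rewrite ra !addA lproj_oppK.
rewrite -la -ra uv; split=> //.
(* Here x e = r(x) + x e = x + a, and a is now known to be the projection -x + e + x. *)
rewrite -[LHS]exe -{1}fe -addA exe rproj_add -addA.
rewrite -/a -aE -uv add_proj //; last exact: lprojP.
by rewrite uv ra !addA -rproj_add fe.
Qed.

(** Replacing e by r(x) e r(x) = r(x) + e + r(x) changes neither side and brings e below r(x). *)
Lemma conj_proj_add x e : is_proj e -> x * e * x^* = - x + e + x.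
Proof.
move=> pe; have pf := rprojP x; have pg := proj_sandwich pf pe.
have gf : rproj x * e * rproj x * rproj x = rproj x * e * rproj x.
  by rewrite -mulA pf.2.
have [gE _] := conj_restrict pg gf.
have -> : - x + e + x = - x + rproj x * e * rproj x + x.
  rewrite -proj_addE // !addA -(addA _ (rproj x) x) add_rproj.
  by rewrite -lproj_opp add_lproj.
by rewrite -gE !mulA rprojK -!mulA -lproj_star lprojK.
Qed.

(** * Complete regularity *)

(** Put m = l(x) and f = r(x); both sides equal m + f + x. Indeed x m = m + f + x m = m + x (m f),
    because m f = f + m, and x (m f) = x (f m f) = f m f + x by [conj_restrict]. *)
Lemma mulr_lproj x : x * lproj x = lproj x + x.
Proof.
have [pm pf] := (lprojP x, rprojP x); have pg := proj_sandwich pf pm.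
have rxm : rproj (x * lproj x) = lproj x * rproj x * lproj x.
  by rewrite !rprojE starM pm.1 !mulA.
have mxm : lproj x + x * lproj x = x * lproj x.
  rewrite -{1}(add_rproj (x * lproj x)) addA.
  rewrite (proj_le_add pm (rprojP _) _).2 ?add_rproj //.
  by rewrite rxm -mulA pm.2.
have -> : x * lproj x = lproj x + rproj x + x * lproj x.
  by rewrite -{1}(add_rproj (x * lproj x)) rxm -proj_addE // -addA mxm.
have -> : lproj x + x = lproj x + rproj x + x by rewrite -addA add_rproj.
have -> : lproj x + rproj x + x * lproj x
    = lproj x + x * (lproj x * rproj x).
  by rewrite (projM_add pm pf) mulD rprojK -rproj_add addA.
have gf : rproj x * lproj x * rproj x * rproj x = rproj x * lproj x * rproj x.
  by rewrite -mulA pf.2.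
have [_ xg] := conj_restrict pg gf.
have -> : x * (lproj x * rproj x) = x * (rproj x * lproj x * rproj x).
  by rewrite !mulA rprojK.
by rewrite xg -proj_addE // !addA -(addA _ (lproj x)) add_proj_idem.
Qed.

(** Put u = x^* and w = -u. Expanding x l(x) = x (u + w) and x = x r(x) = x (w + u) gives x l(x) =
    -x + x w and x = x w - x + l(x). So l(x) = -x + x = x l(x) - x + l(x), which is l(x) + r(x) +
    l(x) by [mulr_lproj]. *)
Lemma proj_sandwich_lr x : lproj x * rproj x * lproj x = lproj x.
Proof.
have [pm pf] := (lprojP x, rprojP x).
have xm : x * lproj x = - x + x * - x^*.
  have := mulD x x^* (- x^*).
  by rewrite -rproj_add rproj_star -lprojE lproj_oppK.
have xE : x = x * - x^* - x + lproj x.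
  have := mulD x (- x^*) (x^* * lproj x).
  by rewrite star_lproj -lproj_add lproj_star rprojK -lprojE.
have mE : lproj x = x * lproj x - x + lproj x.
  by rewrite xm {1}lproj_add {2}xE !addA.
rewrite -proj_addE // [RHS]mE mulr_lproj.
by rewrite -(addA _ x) rproj_add.
Qed.

Lemma proj_sandwich_rl x : rproj x * lproj x * rproj x = rproj x.
Proof. by have := proj_sandwich_lr x^*; rewrite lproj_star rproj_star. Qed.

(** These equations place x in x x S and in S x x, as Green's relation H between x and x x
    demands. *)
Lemma completely_regular_eq x :
  x = x * x * x^* * x^* * x /\ x = x * x^* * x^* * x * x.
Proof.
split.
  by rewrite -{1}(rprojK x) -{1}(proj_sandwich_rl x) lprojE rprojE !mulA mulK.
rewrite -{1}(lprojK x) -{1}(proj_sandwich_lr x) -!mulA lprojK.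
by rewrite lprojE rprojE !mulA.
Qed.

(** * The preorder of J-classes *)

(* The order of J-classes; for projections, J-comparison with the second one is
   [e * f * e = e]. *)
Definition dle x y := lproj x * lproj y * lproj x = lproj x.

Lemma lproj_lproj x : lproj (lproj x) = lproj x.
Proof. exact/lproj_id/lprojP. Qed.

Lemma lproj_rproj x : lproj (rproj x) = rproj x.
Proof. exact/lproj_id/rprojP. Qed.

Lemma dle_refl x : dle x x.
Proof. by rewrite /dle !(lprojP x).2. Qed.

Lemma lproj_least x e : is_proj e -> e * x = x -> e * lproj x = lproj x.
Proof. by move=> pe ex; rewrite lprojE mulA ex. Qed.

Lemma lprojMl x y : lproj x * lproj (x * y) = lproj (x * y).
Proof. by apply: lproj_least (lprojP x) _; rewrite mulA lprojK. Qed.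

Lemma proj_le_antisym e h : is_proj e -> is_proj h ->
  e * h = h -> h * e = e -> e = h.
Proof.
move=> [se _] [sh _] /(congr1 (@bstar S)) eh he.
by rewrite -he -[RHS]sh -eh starM se sh.
Qed.

(** The projection k = r(e f h) lies below h, and l(e f h) = e, so e k e = e by [proj_sandwich_lr].
    Since e k = e h k, e = l(e h k) lies below l(e h) = e h e, which lies below e. *)
Lemma proj_sandwich_trans e f h : is_proj e -> is_proj f -> is_proj h ->
  e * f * e = e -> f * h * f = f -> e * h * e = e.
Proof.
move=> pe pf ph efe fhf.
pose k := rproj (e * f * h).
have pk : is_proj k := rprojP _.
have hk : k * h = k.
  by rewrite /k rprojE starM -!mulA ph.2.
have lk : lproj (e * f * h) = e.
  rewrite lprojE !starM pe.1 pf.1 ph.1 -[RHS]efe -{3}fhf.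
  by rewrite !mulA -(mulA _ h h) ph.2.
have eke : e * k * e = e by rewrite -lk; apply: proj_sandwich_lr.
have ehk : e * k = e * h * k by rewrite -mulA (proj_le_sym ph pk hk).
have g : lproj (e * h) * e = e.
  have := lprojMl (e * h) k; rewrite -ehk.
  by rewrite (lprojM pe pk) eke.
apply: (proj_le_antisym (proj_sandwich pe ph) pe); rewrite -?lprojM //.
by apply: lproj_least; rewrite // mulA pe.2.
Qed.

Lemma dle_trans y x z : dle x y -> dle y z -> dle x z.
Proof. by apply: proj_sandwich_trans; apply: lprojP. Qed.

(* J-equivalence, which is also Green's relation D here. *)
Definition deq x y := dle x y /\ dle y x.

Lemma deq_sym x y : deq x y -> deq y x. Proof. by case. Qed.

Lemma deq_trans y x z : deq x y -> deq y z -> deq x z.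
Proof. by move=> [? ?] [? ?]; split; apply: (dle_trans (y := y)). Qed.

Lemma deq_lproj x : deq x (lproj x).
Proof. by split; rewrite /dle lproj_lproj !(lprojP x).2. Qed.

Lemma deq_rproj x : deq x (rproj x).
Proof.
by split; rewrite /dle lproj_rproj ?proj_sandwich_lr ?proj_sandwich_rl.
Qed.

Lemma deq_star x : deq x^* x.
Proof.
apply: (deq_trans (deq_lproj _)); rewrite lproj_star.
exact/deq_sym/deq_rproj.
Qed.

Lemma deq_opp x : deq (- x) x.
Proof.
apply: (deq_trans (deq_lproj _)); rewrite lproj_opp.
exact/deq_sym/deq_rproj.
Qed.

Lemma proj_le_dle e f : is_proj e -> is_proj f -> f * e = e -> dle e f.
Proof.
by move=> pe pf fe; rewrite /dle !lproj_id // -mulA fe pe.2.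
Qed.

Lemma dle_mull x y : dle (x * y) x.
Proof.
apply: (dle_trans (deq_lproj _).1); apply: (dle_trans _ (deq_lproj x).2).
by apply: proj_le_dle (lprojP _) (lprojP _) (lprojMl x y).
Qed.

Lemma dle_mulr x y : dle (x * y) y.
Proof.
apply: (dle_trans (deq_star (x * y)).2); apply: (dle_trans _ (deq_star y).1).
by rewrite starM; apply: dle_mull.
Qed.

(** The projection k = h e h is J-equivalent to e, so k f k = k by transitivity; as k lies below h,
    this also reads k (h f h) k = k. *)
Lemma proj_sandwich_glb e f h : is_proj e -> is_proj f -> is_proj h ->
  e * f * e = e -> e * h * e = e -> e * (h * f * h) * e = e.
Proof.
move=> pe pf ph efe ehe; have pk := proj_sandwich ph pe.
have eke : e * (h * e * h) * e = e.
  by rewrite !mulA !ehe.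
have kek : h * e * h * e * (h * e * h) = h * e * h.
  have -> : h * e * h * e = h * e by rewrite -!mulA (mulA e h e) ehe.
  by rewrite !mulA -(mulA h e h) -(mulA h (e * h) e) ehe.
have kfk := proj_sandwich_trans pk pe pf kek efe.
have pg := proj_sandwich ph pf.
apply: (proj_sandwich_trans pe pk pg eke).
rewrite !mulA -(mulA _ h h) ph.2 -(mulA _ h h) ph.2.
by move: kfk; rewrite !mulA.
Qed.

(** The product x y is J-equivalent to the projection l(y) r(x) l(y), to which [proj_sandwich_glb]
    applies. *)
Lemma dle_mul z x y : dle z x -> dle z y -> dle z (x * y).
Proof.
move=> zx zy; have {}zx := dle_trans zx (deq_rproj x).1.
have rxy : rproj (x * lproj y) = lproj y * rproj x * lproj y.
  by rewrite !rprojE starM (lprojP y).1 !mulA.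
have lxy : lproj (x * lproj y) = lproj (x * y).
  rewrite (lprojE (x * lproj y)) starM (lprojP y).1 mulA -(mulA x) (lprojP y).2.
  by rewrite !lprojE starM !mulA.
apply: (dle_trans _ (deq_lproj (x * y)).2); rewrite -lxy.
apply: (dle_trans _ (deq_lproj (x * lproj y)).1).
apply: (dle_trans _ (deq_rproj (x * lproj y)).2).
have pxy := rprojP (x * lproj y).
rewrite /dle (lproj_id pxy) rxy; apply: proj_sandwich_glb => //.
- exact: lprojP.
- exact: rprojP.
- exact: lprojP.
by move: zx; rewrite /dle lproj_rproj.
Qed.

(** By [conj_proj_add], l(x + y) = -y + l(x) + y = y l(x) y^* = l(y x). *)
Lemma deq_add x y : deq (x + y) (y * x).
Proof.
apply: (deq_trans (deq_lproj _)); apply/deq_sym.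
rewrite lproj_add oppD addA -(addA (- y)) -lproj_add -conj_proj_add //.
  have -> : y * lproj x * y^* = lproj (y * x) by rewrite !lprojE starM !mulA.
  exact: deq_lproj.
exact: lprojP.
Qed.

Lemma deq_addM x y : deq (x + y) (x * y).
Proof.
apply: (deq_trans (deq_add x y)); split; apply: dle_mul.
- exact: dle_mulr.
- exact: dle_mull.
- exact: dle_mulr.
- exact: dle_mull.
Qed.

(** * Restriction to a lower J-class *)

(* When [dle b x], the only projection below [lproj x] in the J-class of [b]. *)
Definition lbase b x := lproj x * lproj b * lproj x.

(** The image of x under the structure map to the J-class of b, when [dle b x]. *)
Definition strand b x := lbase b x * x.

Lemma lbase_proj b x : is_proj (lbase b x).
Proof. exact: proj_sandwich (lprojP x) (lprojP b). Qed.

Lemma lbase_le b x : lbase b x * lproj x = lbase b x.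
Proof. by rewrite /lbase -mulA (lprojP x).2. Qed.

Lemma deq_lbase b x : dle b x -> deq (lbase b x) b.
Proof.
move=> bx; have [pm pb] := (lprojP x, lprojP b).
rewrite /lbase -lprojM //; apply: (deq_trans (deq_sym (deq_lproj _))).
apply: (deq_trans _ (deq_sym (deq_lproj b))); split; first exact: dle_mulr.
apply: dle_mul; last exact: dle_refl.
apply: (dle_trans (deq_lproj _).2); exact: (dle_trans bx (deq_lproj x).1).
Qed.

Lemma lbase_uniq b x e : dle b x ->
  is_proj e -> e * lproj x = e -> deq e b -> lbase b x = e.
Proof.
move=> bx pe ex eb; have pg := lbase_proj b x.
have [ge eg] := deq_trans (deq_lbase bx) (deq_sym eb).
apply: (proj_uniq pg pe (lprojP x) (lbase_le b x) ex).
  by move: ge; rewrite /dle !lproj_id.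
by move: eg; rewrite /dle !lproj_id.
Qed.

Lemma lbase_restrict b x z :
  dle b x -> dle b z -> lproj z * lproj x = lproj z -> lbase b x = lbase b z.
Proof.
move=> bx bz zx; apply: lbase_uniq => //; first exact: lbase_proj.
  by rewrite -lbase_le -mulA zx.
exact: deq_lbase.
Qed.

Lemma lproj_strand b x : lproj (strand b x) = lbase b x.
Proof.
have [sg gg] := lbase_proj b x.
by rewrite lprojE /strand starM sg mulA -(mulA _ x) -lprojE lbase_le.
Qed.

Lemma deq_strand b x : dle b x -> deq (strand b x) b.
Proof.
move=> bx; apply: (deq_trans (deq_lproj _)); rewrite lproj_strand.
exact: deq_lbase.
Qed.

Lemma dle_star b x : dle b x -> dle b x^*.
Proof. by move=> bx; apply: (dle_trans bx (deq_star x).2). Qed.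

(** With e = [lbase b x^*], the projection x e x^* lies below l(x) in the class of b, so it is
    [lbase b x]; it is also -x + e + x. Restriction can thus be done on either side and with either
    operation. *)
Lemma strand_rproj b x : dle b x ->
  [/\ strand b x = x * lbase b x^*, strand b x = lbase b x^* + x
    & strand b x = x + lbase b x].
Proof.
move=> bx; have bs := dle_star bx.
have pe := lbase_proj b x^*; have eb := deq_lbase bs.
set e := lbase b x^* in pe eb *.
have ex : e * rproj x = e by rewrite -lproj_star lbase_le.
have [_ fe] := proj_le_add (rprojP x) pe ex.
have [uE xe] := conj_restrict pe ex.
have lE : lbase b x = x * e * x^*.
  apply: lbase_uniq => //; first exact: proj_conj.
    by rewrite -mulA star_lproj.
  have -> : x * e * x^* = lproj (x * e).
    by rewrite lprojE starM pe.1 mulA -(mulA x e e) pe.2.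
  apply: (deq_trans (deq_sym (deq_lproj _))); apply: (deq_trans _ eb).
  apply: (deq_trans (deq_rproj _)).
  by rewrite rprojE starM pe.1 mulA -(mulA e) -rprojE ex pe.2;
     split; exact: dle_refl.
have -> : strand b x = x * e by rewrite /strand lE -mulA -rprojE -mulA ex.
by rewrite lE uE !addA -rproj_add fe xe.
Qed.

(** As l(x y) lies below l(x) and r(x y) below r(y), the left base of x and the right base of y are
    those of x y; restrict x on the left and y on the right. *)
Lemma strand_mul b x y :
  dle b (x * y) -> strand b x * strand b y = strand b (x * y).
Proof.
move=> bxy; have bx := dle_trans bxy (dle_mull x y).
have b_y := dle_trans bxy (dle_mulr x y).
have lE : lbase b x = lbase b (x * y).
  apply: lbase_restrict => //.
  by apply: proj_ge_sym (lprojMl x y); apply: lprojP.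
have rE : lbase b y^* = lbase b (x * y)^*.
  rewrite starM; apply: lbase_restrict; rewrite -?starM; try exact: dle_star.
  by rewrite starM; apply: proj_ge_sym (lprojMl _ _); apply: lprojP.
have [syE _ _] := strand_rproj b_y; have [sE _ _] := strand_rproj bxy.
rewrite syE rE {1}/strand lE mulA -(mulA _ x y) -mulA -sE /strand mulA.
by rewrite (lbase_proj b (x * y)).2.
Qed.

(** The sides are exchanged with respect to [strand_mul]: l(x + y) lies below l(y) and r(x + y)
    below r(x). *)
Lemma strand_add b x y :
  dle b (x + y) -> strand b x + strand b y = strand b (x + y).
Proof.
move=> bxy; have bm := dle_trans bxy (deq_addM x y).1.
have bx := dle_trans bm (dle_mull x y).
have b_y := dle_trans bm (dle_mulr x y).
have lE : lbase b y = lbase b (x + y).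
  apply: lbase_restrict => //; apply: proj_add_le; try exact: lprojP.
  by rewrite (lproj_add (x + y)) oppD !addA lproj_oppK.
have rE : lbase b x^* = lbase b (x + y)^*.
  apply: lbase_restrict; try exact: dle_star.
  rewrite !lproj_star; apply: proj_add_le; try exact: rprojP.
  by rewrite (rproj_add (x + y)) oppD !addA add_rproj.
have [_ sxE _] := strand_rproj bx; have [_ _ syE] := strand_rproj b_y.
have [_ sE sE'] := strand_rproj bxy.
rewrite sxE syE rE lE addA -(addA _ x y) -addA -sE' sE addA.
by rewrite add_proj //; apply: lbase_proj.
Qed.

Lemma strand_opp b x : dle b x -> strand b (- x) = - strand b x.
Proof.
move=> bx; have bn := dle_trans bx (deq_opp x).2.
have [_ -> _] := strand_rproj bx; have [_ _ ->] := strand_rproj bn.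
rewrite oppD (opp_proj (lbase_proj _ _)).
by rewrite /lbase lproj_opp lproj_star.
Qed.

Lemma strand_star b x : dle b x -> strand b x^* = (strand b x)^*.
Proof.
move=> bx; have [-> _ _] := strand_rproj bx.
by rewrite starM (lbase_proj b x^*).1.
Qed.

Lemma strand_comp c b x :
  dle c b -> dle b x -> strand c (strand b x) = strand c x.
Proof.
move=> cb bx; have cs := dle_trans cb (deq_strand bx).2.
have sE : strand b x = lproj (strand b x) * x by rewrite lproj_strand.
rewrite -[LHS]/(lbase c (strand b x) * strand b x) {2}sE mulA lbase_le.
congr (_ * x); apply/esym/lbase_restrict => //; first exact: dle_trans bx.
by rewrite lproj_strand lbase_le.
Qed.

Lemma strand_id b x : deq b x -> strand b x = x.
Proof.
move=> bx; rewrite /strand (lbase_uniq (e := lproj x)) ?lprojK //.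
- exact: bx.1.
- exact: lprojP.
- exact: (lprojP x).2.
by apply/deq_sym/(deq_trans bx)/deq_lproj.
Qed.

(** * Representatives of J-classes *)

Definition rep x : {classic S} :=
  choose (fun y : {classic S} => `[< deq x y >]) (x : {classic S}).

Lemma deq_refl x : deq x x. Proof. by split; apply: dle_refl. Qed.

Lemma deq_rep x : deq x (rep x).
Proof.
apply/asboolP/(@chooseP {classic S} (fun y : {classic S} => `[< deq x y >])).
exact/asboolP/deq_refl.
Qed.

(** Equivalent elements define the same predicate by extensionality, and [choose] does not depend on
    its default once that satisfies the predicate. *)
Lemma rep_eq x y : deq x y -> rep x = rep y.
Proof.
move=> xy; rewrite /rep; set P := fun z : {classic S} => `[< deq x z >].
have -> : (fun z : {classic S} => `[< deq y z >]) = P.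
  apply/funext => z; apply/asbool_equiv_eq; split; apply: deq_trans => //.
  exact: deq_sym.
by apply: choose_id; apply/asboolP => //; apply: deq_refl.
Qed.

End DualWeakBrace.

(** * Decomposition into J-classes *)

Section Converse.
Variables (S : braceAlgebra) (hS : is_dual_weak_left_star_brace S).

(* J-classes are encoded by chosen representatives; the proof argument lets the
   canonical semilattice instance find the brace axioms. *)
Definition dclass of is_dual_weak_left_star_brace S :=
  {x : {classic S} | rep x == x}.

HB.instance Definition _ := Choice.on (dclass hS).

Let Y := dclass hS.

Definition dclass_le (a b : Y) := `[< dle (val a : S) (val b) >].

Lemma dclass_le_refl : reflexive dclass_le.
Proof. by move=> a; apply/asboolP/dle_refl. Qed.

Lemma dclass_le_anti : antisymmetric dclass_le.
Proof.
move=> a b /andP[/asboolP ab /asboolP ba]; apply: val_inj.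
by rewrite -(eqP (valP a)) -(eqP (valP b)); apply: rep_eq.
Qed.

Lemma dclass_le_trans : transitive dclass_le.
Proof.
move=> b a c /asboolP ab /asboolP bc.
by apply/asboolP; apply: (dle_trans _ ab).
Qed.

HB.instance Definition _ := Order.Le_isPOrder.Build (Order.Disp tt tt)
  (dclass hS) dclass_le_refl dclass_le_anti dclass_le_trans.

Lemma rep_rep (x : S) : rep (rep x : S) == rep x.
Proof. by apply/eqP/(rep_eq hS)/(deq_sym)/(deq_rep hS). Qed.

Definition dclass_of (x : S) : Y := exist _ (rep x) (rep_rep x).

Definition dclass_meet (a b : Y) : Y := dclass_of ((val a : S) * (val b : S)).

Lemma dclass_lexI (a b c : Y) :
  (a <= dclass_meet b c)%O = (a <= b)%O && (a <= c)%O.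
Proof.
have [mr rm] := deq_rep hS ((val b : S) * (val c : S)).
apply/asboolP/andP => [am | [/asboolP ab /asboolP ac]].
  have {}am := dle_trans hS am rm.
  by split; apply/asboolP; apply: (dle_trans hS am);
    [apply: dle_mull | apply: dle_mulr].
by apply: (dle_trans hS _ mr); apply: dle_mul.
Qed.

HB.instance Definition _ := Order.POrder_isMeetSemilattice.Build
  (Order.Disp tt tt) (dclass hS) dclass_lexI.

(** * J-classes as square skew left braces *)

Definition in_dclass (a : Y) (x : S) := `[< deq x (val a) >].

Lemma in_dclass_mul a x y :
  in_dclass a x -> in_dclass a y -> in_dclass a (x * y).
Proof.
move=> /asboolP[xa ax] /asboolP[ya ay]; apply/asboolP; split.
  exact: (dle_trans hS (dle_mull hS x y)).
exact: dle_mul.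
Qed.

Lemma in_dclass_add a x y :
  in_dclass a x -> in_dclass a y -> in_dclass a (x + y).
Proof.
move=> xa ya; apply/asboolP/(deq_trans hS (deq_addM hS x y))/asboolP.
exact: in_dclass_mul.
Qed.

Lemma in_dclass_opp a x : in_dclass a x -> in_dclass a (- x).
Proof. by move/asboolP => ?; apply/asboolP/(deq_trans hS (deq_opp hS x)). Qed.

Lemma in_dclass_star a x : in_dclass a x -> in_dclass a x^*.
Proof. by move/asboolP => ?; apply/asboolP/(deq_trans hS (deq_star hS x)). Qed.

Definition component (a : Y) : braceAlgebra := @BraceAlgebra
  {x : S | in_dclass a x}
  (fun x y => exist (in_dclass _) _ (in_dclass_add (valP x) (valP y)))
  (fun x y => exist (in_dclass _) _ (in_dclass_mul (valP x) (valP y)))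
  (fun x => exist (in_dclass _) _ (in_dclass_opp (valP x)))
  (fun x => exist (in_dclass _) _ (in_dclass_star (valP x))).

Definition component_val a (x : component a) : S := val x.

Lemma component_inj a : injective (@component_val a).
Proof. exact: val_inj. Qed.

Lemma component_brace a : is_dual_weak_left_star_brace (component a).
Proof.
have [[[Aa Ar Ai An] [Ma Mr Mi Mn] D P] Q] := hS.
split; [split; [split|split| |] |].
- move=> x y z; apply: component_inj; exact: Aa.
- move=> x; apply: component_inj; exact: Ar.
- move=> x; apply: component_inj; exact: Ai.
- move=> x y; apply: component_inj; exact: An.
- move=> x y z; apply: component_inj; exact: Ma.
- move=> x; apply: component_inj; exact: Mr.
- move=> x; apply: component_inj; exact: Mi.
- move=> x y; apply: component_inj; exact: Mn.
- move=> x y z; apply: component_inj; exact: D.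
- move=> x; apply: component_inj; exact: P.
- move=> x; apply: component_inj; exact: Q.
Qed.

Lemma component_ideal a (x y : component a) : exists s t, y = s * x * t.
Proof.
have /asboolP xa := valP x; have /asboolP ya := valP y.
have [yx _] := deq_trans hS ya (deq_sym xa).
(* With these witnesses s x t = l(y) l(x) l(y) y = l(y) y = y. *)
exists (y * y^*), (x^* * y * y^* * y); apply: component_inj.
rewrite /component_val /=; set u := val y; set v := val x.
have := congr1 (fun t => t * u) yx.
rewrite /= (lprojK hS) !lprojE.
by rewrite !(rss_assoc (wlb_mul hS.1)).
Qed.

Lemma component_completely_simple a :
  is_completely_simple (@bmul (component a)).
Proof.
have mulA := rss_assoc (wlb_mul (component_brace a).1).
split.
  have idealT x : principal_ideal (@bmul (component a)) x = setT.
    rewrite predeqE => y; split=> // _; right.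
    by have [s [t ->]] := component_ideal x y; exists s => //; exists t.
  by move=> x y; rewrite /greenJ !idealT.
(* Relation H is taken inside the component, so the equations are applied to the component as a
   brace of its own. *)
move=> x; have [xl xr] := completely_regular_eq (component_brace a) x.
split; rewrite /greenL /greenR predeqE => y; split.
- case=> [->|[s _ <-]]; right.
    by exists (x * x^* * x^*) => //; rewrite [RHS]xr !mulA.
  by exists (s * (x * x^* * x^*)) => //; rewrite [in RHS]xr !mulA.
- case=> [->|[s _ <-]]; right; first by exists x.
  by exists (s * x) => //; rewrite !mulA.
- case=> [->|[s _ <-]]; right.
    by exists (x^* * x^* * x) => //; rewrite [RHS]xl !mulA.
  by exists (x^* * x^* * x * s) => //; rewrite [in RHS]xl !mulA.
- case=> [->|[s _ <-]]; right; first by exists x.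
  by exists (x * s) => //; rewrite !mulA.
Qed.

(** * Structure maps *)

Lemma dle_component (a b : Y) (x : component a) :
  (b <= a)%O -> dle (val b : S) (val x).
Proof.
by move=> /asboolP ba; have /asboolP[_ ax] := valP x; apply: (dle_trans hS ba).
Qed.

Lemma in_dclass_strand (a b : Y) (ba : (b <= a)%O) (x : component a) :
  in_dclass b (strand (val b) (val x)).
Proof. by apply/asboolP/(deq_strand hS)/(dle_component x ba). Qed.

Definition structure_map (a b : Y) (ba : (b <= a)%O) (x : component a) :
  component b := exist (in_dclass _) _ (in_dclass_strand ba x).

Lemma structure_map_system : is_strong_system structure_map.
Proof.
split.
- move=> a; split; first exact: component_brace.
  exact: component_completely_simple.
- move=> a b ba; have lec := dle_component _ ba.
  split=> [x y | x y | x | x]; apply: component_inj; rewrite /component_val /=.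
  + by rewrite strand_add //; apply: (lec (x + y)).
  + by rewrite strand_mul //; apply: (lec (x * y)).
  + by rewrite strand_opp //; apply: lec.
  + by rewrite strand_star //; apply: lec.
- move=> a aa x; apply: component_inj; apply: (strand_id hS).
  exact/(deq_sym)/asboolP/(valP x).
- move=> a b c ba cb ca x; apply: component_inj; apply: (strand_comp hS).
    exact/asboolP.
  exact: dle_component.
Qed.

Lemma component_inhabited a : inhabited (component a).
Proof.
by constructor; exists (val a : S); apply/asboolP/(deq_refl hS).
Qed.

Lemma dclass_ofE (a : Y) (x : component a) : dclass_of (val x) = a.
Proof.
apply: val_inj; rewrite /= -(eqP (valP a)); apply: (rep_eq hS).
exact/asboolP/(valP x).
Qed.

Lemma in_dclass_of x : in_dclass (dclass_of x) x.
Proof. exact/asboolP/(deq_rep hS). Qed.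

(** * Isomorphism with the strong semilattice *)

Definition forget (p : strong_semilattice structure_map) : S :=
  component_val (tagged p).

Definition classify (x : S) : strong_semilattice structure_map :=
  existT (fun a => component a : Type) (dclass_of x)
    (exist (in_dclass _) x (in_dclass_of x)).

Lemma forgetK : cancel forget classify.
Proof.
move=> [a x]; have ax := dclass_ofE x.
(* The membership proof is generalized so that the index can be rewritten in the dependent pair. *)
rewrite /classify /forget /=; move: (in_dclass_of _).
rewrite /component_val ax => xa.
by congr existT; apply: component_inj.
Qed.

Lemma classifyK : cancel classify forget.
Proof. by []. Qed.

Lemma forget_mulE (p q : strong_semilattice structure_map) :
  let c := val (tag p `&` tag q)%O : S in
  deq c (forget p * forget q).
Proof.
case: p q => [a x] [b y]; rewrite /forget /=.
apply: (deq_trans hS (deq_sym (deq_rep hS _))).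
have /asboolP[xa ax] := valP x; have /asboolP[yb b_y] := valP y.
split; apply: (dle_mul hS).
- exact: (dle_trans hS (dle_mull hS _ _) ax).
- exact: (dle_trans hS (dle_mulr hS _ _) b_y).
- exact: (dle_trans hS (dle_mull hS _ _) xa).
- exact: (dle_trans hS (dle_mulr hS _ _) yb).
Qed.

(** An operation of the strong semilattice first restricts both operands to the class of their
    product. That amounts to restricting the result, which already lies in this class and is
    unchanged. *)
Lemma forget_hom : is_brace_hom forget.
Proof.
split=> // p q; have pq := forget_mulE p q.
  have pq' := deq_trans hS pq (deq_sym (deq_addM hS _ _)).
  rewrite /forget /= /component_val /= strand_add ?strand_id //.
  exact: pq'.1.
rewrite /forget /= /component_val /= strand_mul ?strand_id //.
exact: pq.1.
Qed.

End Converse.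

(** * Strong semilattices *)

Section Forward.
Local Open Scope order_scope.
Context (d : Order.disp_t) (Y : meetSemilatticeType d) (B : Y -> braceAlgebra).
Variable phi : forall a b : Y, b <= a -> B a -> B b.
Hypothesis phiP : is_strong_system phi.
Local Notation T := (strong_semilattice phi).

Let brace a := (sys_square phiP a).1.

(** Comparing images in an arbitrary [B c] avoids transport along the equality of indices; c is then
    taken to be the common index. *)
Lemma strong_semilattice_eq (p q : T) : tag p = tag q ->
  (forall c (pc : c <= tag p) (qc : c <= tag q),
     phi pc (tagged p) = phi qc (tagged q)) -> p = q.
Proof.
case: p q => [a x] [b y] /= e; case: b / e y => y.
by move=> /(_ a (lexx _) (lexx _)); rewrite !(sys_id phiP) => ->.
Qed.

Lemma phi_irrel a b (h h' : b <= a) (x : B a) : phi h x = phi h' x.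
Proof. by rewrite (bool_irrelevance h h'). Qed.

Let leL (a b c : Y) (h : c <= a `&` b) : c <= a := le_trans h (leIl a b).
Let leR (a b c : Y) (h : c <= a `&` b) : c <= b := le_trans h (leIr b a).

(** Successive descents compose by [sys_comp], so iterating this turns an expression in [T] into the
    same expression in the single brace [B c]. *)
Lemma push_add c (p q : T) (h : c <= tag p `&` tag q)
    (hp : c <= tag p) (hq : c <= tag q) :
  phi h (tagged (p + q)%B) = (phi hp (tagged p) + phi hq (tagged q))%B.
Proof. by rewrite /= (hom_add (sys_hom phiP h)) !(sys_comp phiP). Qed.

Lemma push_mul c (p q : T) (h : c <= tag p `&` tag q)
    (hp : c <= tag p) (hq : c <= tag q) :
  phi h (tagged (p * q)%B) = (phi hp (tagged p) * phi hq (tagged q))%B.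
Proof. by rewrite /= (hom_mul (sys_hom phiP h)) !(sys_comp phiP). Qed.

Lemma push_opp c (p : T) (h : c <= tag (- p)%B) (hp : c <= tag p) :
  phi h (tagged (- p)%B) = (- phi hp (tagged p))%B.
Proof. by rewrite (phi_irrel h hp) (hom_opp (sys_hom phiP hp)). Qed.

Lemma push_star c (p : T) (h : c <= tag (p^*)%B) (hp : c <= tag p) :
  phi h (tagged (p^*)%B) = ((phi hp (tagged p))^*)%B.
Proof. by rewrite (phi_irrel h hp) (hom_star (sys_hom phiP hp)). Qed.

Lemma strong_semilattice_brace : is_dual_weak_left_star_brace T.
Proof.
split; [split; [split|split| |] |].
- move=> p q r; apply: strong_semilattice_eq => [|c h1 h2]; first exact: meetA.
  have [[hpq hr] hqr] := (leL h2, leR h2, leR h1).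
  have [hp hq] := (leL hpq, leR hpq).
  rewrite (push_add h1 hp hqr) (push_add hqr hq hr).
  rewrite (push_add h2 hpq hr) (push_add hpq hp hq).
  exact: (rss_assoc (wlb_add (brace c).1)).
- move=> p; apply: strong_semilattice_eq => [|c h1 h].
    by rewrite /= !meetxx.
  have h2 : c <= tag (p - p)%B := leL h1.
  (* Negation keeps the index, so [h] also bounds the index of [- p] by conversion. *)
  rewrite (push_add h1 h2 h) (push_add h2 h (h : c <= tag (- p)%B)).
  rewrite (push_opp _ h).
  exact: (rss_regular (wlb_add (brace c).1)).
- move=> p; apply: strong_semilattice_eq => // c h1 h.
  rewrite (push_opp h1 (h : c <= tag (- p)%B)) (push_opp _ h).
  exact: (rss_involutive (wlb_add (brace c).1)).
- move=> p q; apply: strong_semilattice_eq => [|c h1 h2]; first exact: meetC.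
  have [hp hq] := (leL h1, leR h1).
  rewrite (push_opp h1 (h1 : c <= tag (p + q)%B)) (push_add _ hp hq).
  rewrite (push_add h2 (hq : c <= tag (- q)%B) (hp : c <= tag (- p)%B)).
  rewrite (push_opp _ hq) (push_opp _ hp).
  exact: (rss_anti (wlb_add (brace c).1)).
- move=> p q r; apply: strong_semilattice_eq => [|c h1 h2]; first exact: meetA.
  have [[hpq hr] hqr] := (leL h2, leR h2, leR h1).
  have [hp hq] := (leL hpq, leR hpq).
  rewrite (push_mul h1 hp hqr) (push_mul hqr hq hr).
  rewrite (push_mul h2 hpq hr) (push_mul hpq hp hq).
  exact: (rss_assoc (wlb_mul (brace c).1)).
- move=> p; apply: strong_semilattice_eq => [|c h1 h].
    by rewrite /= !meetxx.
  have h2 : c <= tag (p * p^*)%B := leL h1.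
  rewrite (push_mul h1 h2 h) (push_mul h2 h (h : c <= tag (p^*)%B)).
  rewrite (push_star _ h).
  exact: (rss_regular (wlb_mul (brace c).1)).
- move=> p; apply: strong_semilattice_eq => // c h1 h.
  rewrite (push_star h1 (h : c <= tag (p^*)%B)) (push_star _ h).
  exact: (rss_involutive (wlb_mul (brace c).1)).
- move=> p q; apply: strong_semilattice_eq => [|c h1 h2]; first exact: meetC.
  have [hp hq] := (leL h1, leR h1).
  rewrite (push_star h1 (h1 : c <= tag (p * q)%B)) (push_mul _ hp hq).
  rewrite (push_mul h2 (hq : c <= tag (q^*)%B) (hp : c <= tag (p^*)%B)).
  rewrite (push_star _ hq) (push_star _ hp).
  exact: (rss_anti (wlb_mul (brace c).1)).
- move=> p q r; apply: strong_semilattice_eq => [|c h1 h2].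
    (* The index of p occurs three times on the right of the brace law and collapses by
       idempotence. *)
    by rewrite /= (meetAC (tag p) (tag q)) meetxx meetACA meetxx.
  have hqr : c <= tag (q + r)%B := leR h1.
  have hpqp : c <= tag (p * q - p)%B := leL h2.
  have hpq : c <= tag (p * q)%B := leL hpqp.
  have hpr : c <= tag (p * r)%B := leR h2.
  have [[hp hq] hr] := (leL hpq, leR hpq, leR hpr).
  rewrite (push_mul h1 hp hqr) (push_add hqr hq hr) (push_add h2 hpqp hpr).
  rewrite (push_add hpqp hpq (hp : c <= tag (- p)%B)) (push_opp _ hp).
  rewrite (push_mul hpq hp hq) (push_mul hpr hp hr).
  exact: (wlb_distr (brace c).1).
- move=> p; apply: strong_semilattice_eq => // c h1 h2.
  have h : c <= tag p := leL h1.
  rewrite (push_add h1 (h : c <= tag (- p)%B) h) (push_opp _ h).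
  rewrite (push_mul h2 h (h : c <= tag (p^*)%B)) (push_star _ h).
  exact: (wlb_proj (brace c).1).
- move=> p; apply: strong_semilattice_eq => // c h1 h2.
  have h : c <= tag p := leL h1.
  rewrite (push_add h1 h (h : c <= tag (- p)%B)) (push_opp _ h).
  rewrite (push_mul h2 (h : c <= tag (p^*)%B) h) (push_star _ h).
  exact: (brace c).2.
Qed.

End Forward.

Theorem theorem3p5 :
  (forall (d : Order.disp_t) (Y : meetSemilatticeType d)
          (B : Y -> braceAlgebra)
          (phi : forall a b : Y, (b <= a)%O -> B a -> B b),
     is_strong_system phi ->
     is_dual_weak_left_star_brace (strong_semilattice phi)) /\
  (forall S : braceAlgebra,
     is_dual_weak_left_star_brace S ->
     exists (d : Order.disp_t) (Y : meetSemilatticeType d)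
            (B : Y -> braceAlgebra)
            (phi : forall a b : Y, (b <= a)%O -> B a -> B b),
       is_strong_system phi /\
       (forall a : Y, inhabited (B a)) /\
       exists f : strong_semilattice phi -> S, is_brace_hom f /\ bijective f).
Proof.
split; first by move=> d Y B phi; apply: strong_semilattice_brace.
move=> S hS; exists (Order.Disp tt tt), (dclass hS), (@component S hS),
  (@structure_map S hS).
split; first exact: structure_map_system.
split; first exact: component_inhabited.
exists (@forget S hS); split; first exact: forget_hom.
by exists (@classify S hS); [apply: forgetK | apply: classifyK].
Qed.
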